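(* Let $S$ and $S'$ be finite sequences of simple pattern terms, let $S_1\in\upsilon(S)$ and $S'_1\in\upsilon(S')$, and suppose that $\theta\in\mathit{mgu}(S_1,S'_1)$ is a simple substitution. Then $\upsilon^{-1}(\theta)$ is a most general unifier of $S$ and $S'$ (in the sense of pattern terms). Equivalently: if the unification algorithm (choose $S_1\in\upsilon(S)$, $S'_1\in\upsilon(S')$; if $\mathit{mgu}(S_1,S'_1)$ contains a simple substitution $\theta$, return $\upsilon^{-1}(\theta)$, else fail) terminates successfully, its output is an mgu of $S$ and $S'$.
   Context: Fix a signature $\Sigma$, hole constants $\square_1,\square_2,\dots$ and an infinite countable set $X$ of variables, pairwise disjoint. $T(\Sigma,X)$ is the set of terms, $S(\Sigma,X)$ the set of substitutions; composition $x(\sigma\theta)=(x\sigma)\theta$, $\emptyset$ the identity, $\sigma^0=\emptyset$, $\sigma^{n+1}=\sigma^n\sigma$. A 1-context is a term over $\Sigma\cup\{\square_1,\square_2,\dots\}$ and $X$ containing $\square_1$ and no other hole; $c(s)$ replaces every $\square_1$ by $s$; $c^0=\square_1$, $c^{n+1}=c(c^n)$; $\chi^{(1)}$ is the set of 1-contexts without variables. $\Upsilon$ is a set of new unary function symbols $c^{a,b}$ ($c\in\chi^{(1)}$, $a,b\in\mathbb N$). $\mathit{mgu}(S_1,S'_1)$ for sequences in $T(\Sigma\cup\Upsilon,X)$ is the usual set of most general unifiers, treating symbols of $\Upsilon$ as ordinary unary function symbols. For $u\in T(\Sigma\cup\Upsilon,X)$, $u(n)\in T(\Sigma,X)$ is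 obtained by replacing every symbol $c^{a,b}$ by the nesting $c^{a\times n+b}$; for $\theta\in S(\Sigma\cup\Upsilon,X)$, $(\theta(n))(x)=(\theta(x))(n)$. $u\sim v$ iff $u(n)=v(n)$ for all $n$; $[u]$ is the $\sim$-class. A pattern substitution is a pair $(\sigma,\mu)\in S(\Sigma,X)^2$ with $(\sigma,\mu)(n)=\sigma^n\mu$. A pattern term is $p=(s,(\sigma,\mu))$, $s\in T(\Sigma,X)$, with $p(n)=s\sigma^n\mu$. A pattern substitution $\vartheta$ is a most general unifier of two sequences $\langle p_1,\dots,p_m\rangle$, $\langle q_1,\dots,q_m\rangle$ of pattern terms if for every $n\in\mathbb N$, $\vartheta(n)\in\mathit{mgu}(\langle p_1(n),\dots,p_m(n)\rangle,\langle q_1(n),\dots,q_m(n)\rangle)$. A pattern term $p=(s,(\sigma,\mu))$ is simple if for every $x\in\mathit{Var}(s)$ there exist $c\in\chi^{(1)}$, $a,b\in\mathbb N$, $t\in T(\Sigma,X)$ with $\sigma(x)=c^a(x)$ and $\mu(x)=c^b(t)$; then $\upsilon(p)=[s\theta_p]$, where $\theta_p(x)=\mu(x)$ if $\sigma(x)=x$ and $\theta_p(x)=c^{a,b}(t)$ otherwise ($x\in\mathit{Var}(s)$). For a sequence $S=\langle p_1,\dots,p_m\rangle$ of simple pattern terms, $\upsilon(S)=\{\langle u_1,\dots,u_m\rangle\mid u_i\in\upsilon(p_i)\}$. A substitution $\theta\in S(\Sigma\cup\Upsilon,X)$ is simple if for every $x\in X$, $\theta(x)\in[c^{a,b}(t)]$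 for some $c\in\chi^{(1)}$, $a,b\in\mathbb N$, $t\in T(\Sigma,X)$; then $\upsilon^{-1}(\theta)$ is the pattern substitution $(\sigma,\mu)$ with $\sigma(x)=c^a(x)$ and $\mu(x)=c^b(t)$ whenever $\theta(x)\in[c^{a,b}(t)]$. *)

(* Defs.v *)
From mathcomp Require Import all_boot.
From mathcomp Require Import boolp.
From Stdlib Require List.
From Stdlib Require Import Eqdep.

Set Implicit Arguments.
Unset Strict Implicit.
Unset Printing Implicit Defensive.

Record signature := Signature { sym : Type; arity : sym -> nat }.

Unset Elimination Schemes.
Inductive term (Sg : signature) (X : Type) : Type :=
| Var of X
| App (f : sym Sg) of {ffun 'I_(arity f) -> term Sg X}.
Set Elimination Schemes.

Arguments Var {Sg X} x.
Arguments App {Sg X} f args.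

Definition term_ind (Sg : signature) (X : Type) (P : term Sg X -> Prop)
    (HV : forall x, P (Var x))
    (HA : forall (f : sym Sg) (args : {ffun 'I_(arity f) -> term Sg X}),
       (forall i, P (args i)) -> P (App f args)) :=
  fix F (t : term Sg X) : P t :=
    match t with
    | Var x => HV x
    | App f args => HA f args (fun i => F (args i))
    end.

Fixpoint vars (Sg : signature) (X : Type) (t : term Sg X) : seq X :=
  match t with
  | Var x => [:: x]
  | App f args => flatten (codom (fun i => vars (args i)))
  end.

Fixpoint app_fun (Sg : signature) (X : Type) (g : X -> term Sg X)
    (t : term Sg X) : term Sg X :=
  match t with
  | Var x => g x
  | App f args => App f [ffun i => app_fun g (args i)]
  end.

(* Substitutions have finite domain. *)
Record subst (Sg : signature) (X : countType) := Subst {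
  subst_fun :> X -> term Sg X;
  subst_finite : exists D : seq X, forall x, x \notin D -> subst_fun x = Var x
}.

Definition app_subst (Sg : signature) (X : countType) (t : term Sg X)
  (theta : subst Sg X) : term Sg X := app_fun theta t.

Lemma id_subst_finite (Sg : signature) (X : countType) :
  exists D : seq X, forall x, x \notin D -> @Var Sg X x = Var x.
Proof. by exists [::]. Qed.

Definition id_subst (Sg : signature) (X : countType) : subst Sg X :=
  Subst (id_subst_finite Sg X).

Lemma comp_subst_finite (Sg : signature) (X : countType)
    (sigma theta : subst Sg X) :
  exists D : seq X, forall x, x \notin D -> app_subst (sigma x) theta = Var x.
Proof.
have [D1 H1] := subst_finite sigma; have [D2 H2] := subst_finite theta.
exists (D1 ++ D2) => x; rewrite mem_cat negb_or => /andP[/H1 -> /H2 Hx].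
exact: Hx.
Qed.

(* x (sigma theta) = (x sigma) theta *)
Definition comp_subst (Sg : signature) (X : countType)
  (sigma theta : subst Sg X) : subst Sg X :=
  Subst (comp_subst_finite sigma theta).

Fixpoint pow_subst (Sg : signature) (X : countType) (sigma : subst Sg X)
    (n : nat) : subst Sg X :=
  if n is m.+1 then comp_subst (pow_subst sigma m) sigma else id_subst Sg X.

(* Sequences of different lengths have no unifier. *)
Definition unifier (Sg : signature) (X : countType) (T T' : seq (term Sg X))
  (theta : subst Sg X) : Prop :=
  [seq app_subst t theta | t <- T] = [seq app_subst t theta | t <- T'].

Definition mgu (Sg : signature) (X : countType) (T T' : seq (term Sg X))
  (theta : subst Sg X) : Prop :=
  unifier T T' theta /\
  forall eta : subst Sg X, unifier T T' eta ->
    exists delta : subst Sg X, eta =1 comp_subst theta delta.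

(* The only hole of a 1-context is the first one, added here as the constant  *)
(* [None]; terms without variables are terms over [void].                     *)
Definition hole_sig (Sg : signature) : signature :=
  @Signature (option (sym Sg)) (fun o => if o is Some f then arity f else 0).

Definition hole_term (Sg : signature) := term (hole_sig Sg) void.

Definition hole (Sg : signature) : hole_term Sg :=
  @App (hole_sig Sg) void None (ffun0 (card_ord 0)).

Fixpoint has_hole (Sg : signature) (c : hole_term Sg) : bool :=
  match c with
  | Var v => match v with end
  | App None _ => true
  | App (Some f) args => has id (codom (fun i => has_hole (args i)))
  end.

(* The set chi^(1) of 1-contexts without variables. *)
Record ctx (Sg : signature) := Ctx {
  ctx_term :> hole_term Sg;
  ctx_has_hole : has_hole ctx_term
}.

Fixpoint ctx_comp (Sg : signature) (c d : hole_term Sg) : hole_term Sg :=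
  match c with
  | Var v => match v with end
  | App None _ => d
  | App (Some f) args =>
      @App (hole_sig Sg) void (Some f) [ffun i => ctx_comp (args i) d]
  end.

Fixpoint ctx_pow (Sg : signature) (c : hole_term Sg) (n : nat) : hole_term Sg :=
  if n is m.+1 then ctx_comp c (ctx_pow c m) else hole Sg.

Fixpoint plug (Sg : signature) (X : Type) (c : hole_term Sg) (s : term Sg X)
    : term Sg X :=
  match c with
  | Var v => match v with end
  | App None _ => s
  | App (Some f) args => @App Sg X f [ffun i => plug (args i) s]
  end.

(* The signature extended with the unary symbols c^{a,b}. *)
Definition ups_sig (Sg : signature) : signature :=
  @Signature (sym Sg + ctx Sg * nat * nat)
    (fun o => match o with inl f => arity f | inr _ => 1 end).

Fixpoint lift_term (Sg : signature) (X : Type) (t : term Sg X)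
    : term (ups_sig Sg) X :=
  match t with
  | Var x => Var x
  | App f args => @App (ups_sig Sg) X (inl f) [ffun i => lift_term (args i)]
  end.

(* The term c^{a,b}(t). *)
Definition ups_app (Sg : signature) (X : Type) (c : ctx Sg) (a b : nat)
  (t : term Sg X) : term (ups_sig Sg) X :=
  @App (ups_sig Sg) X (inr (c, a, b)) [ffun _ => lift_term t].

Fixpoint ups_eval (Sg : signature) (X : Type) (u : term (ups_sig Sg) X)
    (n : nat) : term Sg X :=
  match u with
  | Var x => Var x
  | App (inl f) args => @App Sg X f [ffun i => ups_eval (args i) n]
  | App (inr (c, a, b)) args =>
      plug (ctx_pow c (a * n + b)) (ups_eval (args ord0) n)
  end.

Definition ups_equiv (Sg : signature) (X : Type) (u v : term (ups_sig Sg) X)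
  : Prop := forall n, ups_eval u n = ups_eval v n.

Definition pat_subst (Sg : signature) (X : countType) : Type :=
  (subst Sg X * subst Sg X)%type.

Definition pat_subst_eval (Sg : signature) (X : countType)
  (vt : pat_subst Sg X) (n : nat) : subst Sg X :=
  comp_subst (pow_subst vt.1 n) vt.2.

Definition pat_term (Sg : signature) (X : countType) : Type :=
  (term Sg X * pat_subst Sg X)%type.

Definition pat_term_eval (Sg : signature) (X : countType)
  (p : pat_term Sg X) (n : nat) : term Sg X :=
  app_subst (app_subst p.1 (pow_subst p.2.1 n)) p.2.2.

Definition pat_mgu (Sg : signature) (X : countType)
  (S S' : seq (pat_term Sg X)) (vt : pat_subst Sg X) : Prop :=
  forall n, mgu [seq pat_term_eval p n | p <- S]
                [seq pat_term_eval q n | q <- S'] (pat_subst_eval vt n).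

(* sigma(x) = c^a(x) and mu(x) = c^b(t) *)
Definition simple_at (Sg : signature) (X : countType) (vt : pat_subst Sg X)
  (x : X) (c : ctx Sg) (a b : nat) (t : term Sg X) : Prop :=
  vt.1 x = plug (ctx_pow c a) (Var x) /\ vt.2 x = plug (ctx_pow c b) t.

Definition simple_pat_term (Sg : signature) (X : countType)
  (p : pat_term Sg X) : Prop :=
  forall x, x \in vars p.1 -> exists c a b t, simple_at p.2 x c a b t.

(* theta is a possible choice of theta_p: the decomposition c, a, b, t of p at *)
(* a variable is not unique, but the class of s theta_p does not depend on it. *)
Definition is_theta_of (Sg : signature) (X : countType) (p : pat_term Sg X)
  (theta : subst (ups_sig Sg) X) : Prop :=
  forall x, x \in vars p.1 ->
    (p.2.1 x = Var x -> theta x = lift_term (p.2.2 x)) /\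
    (p.2.1 x <> Var x -> exists c a b t,
       simple_at p.2 x c a b t /\ theta x = ups_app c a b t).

(* u belongs to upsilon(p) *)
Definition in_upsilon (Sg : signature) (X : countType) (p : pat_term Sg X)
  (u : term (ups_sig Sg) X) : Prop :=
  exists theta, is_theta_of p theta /\
    ups_equiv u (app_subst (lift_term p.1) theta).

Definition in_upsilon_seq (Sg : signature) (X : countType)
  (S : seq (pat_term Sg X)) (U : seq (term (ups_sig Sg) X)) : Prop :=
  List.Forall2 (@in_upsilon Sg X) S U.

Definition simple_subst (Sg : signature) (X : countType)
  (theta : subst (ups_sig Sg) X) : Prop :=
  forall x, exists c a b t, ups_equiv (theta x) (ups_app c a b t).

Definition is_upsilon_inv (Sg : signature) (X : countType)
  (theta : subst (ups_sig Sg) X) (vt : pat_subst Sg X) : Prop :=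
  forall x c a b t, ups_equiv (theta x) (ups_app c a b t) ->
    simple_at vt x c a b t.

(* The rest shows that [is_upsilon_inv theta] determines a pattern            *)
(* substitution when theta is simple, so that upsilon^{-1} is well defined.   *)

Lemma App_inj (Sg : signature) (X : Type) (f : sym Sg)
    (a b : {ffun 'I_(arity f) -> term Sg X}) : App f a = App f b -> a = b.
Proof. by case=> /(@inj_pair2 _ _ _ _ _). Qed.

Lemma plug_comp (Sg : signature) (X : Type) (c d : hole_term Sg)
    (s : term Sg X) : plug (ctx_comp c d) s = plug c (plug d s).
Proof.
elim: c => [[]|[f|] args IH] //=.
by congr App; apply/ffunP => i; rewrite !ffunE; apply: IH.
Qed.

Lemma plug_powD (Sg : signature) (X : Type) (c : hole_term Sg) (m n : nat)
    (s : term Sg X) :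
  plug (ctx_pow c (m + n)) s = plug (ctx_pow c m) (plug (ctx_pow c n) s).
Proof. by elim: m => //= m IH; rewrite !plug_comp IH. Qed.

Lemma has_hole_comp (Sg : signature) (c d : hole_term Sg) :
  has_hole c -> has_hole d -> has_hole (ctx_comp c d).
Proof.
elim: c => [[]|[f|] args IH] //= + hd.
move=> /hasP[_ /codomP[i ->] /= hi]; apply/hasP; exists true => //.
by apply/codomP; exists i; rewrite ffunE; apply/esym/IH.
Qed.

Lemma has_hole_pow (Sg : signature) (c : hole_term Sg) (n : nat) :
  has_hole c -> has_hole (ctx_pow c n).
Proof. by move=> hc; elim: n => //= n; apply: has_hole_comp. Qed.

Fixpoint term_size (Sg : signature) (X : Type) (t : term Sg X) : nat :=
  match t with
  | Var x => 0
  | App f args => (sumn (codom (fun i => term_size (args i)))).+1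
  end.

Lemma term_size_arg (Sg : signature) (X : Type) (f : sym Sg)
    (args : {ffun 'I_(arity f) -> term Sg X}) i :
  term_size (args i) < term_size (App f args).
Proof.
rewrite ltnS /= sumnE big_map -/(enum _) big_enum /=.
by rewrite (bigD1 i) //= leq_addr.
Qed.

Lemma plug_size (Sg : signature) (X : Type) (c : hole_term Sg)
    (s : term Sg X) : has_hole c -> term_size s <= term_size (plug c s).
Proof.
elim: c => [[]|[f|] args IH] //= /hasP[_ /codomP[i ->] /= hi].
apply: leq_trans (IH i hi) (ltnW _).
by have := @term_size_arg _ _ f [ffun i => plug (args i) s] i; rewrite ffunE.
Qed.

Lemma nullary_hole (Sg : signature) args :
  @App (hole_sig Sg) void None args = hole Sg.
Proof. by congr App; apply/ffunP => -[]. Qed.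

Lemma plug_fix (Sg : signature) (X : Type) (c : hole_term Sg)
    (s : term Sg X) : has_hole c -> plug c s = s -> c = hole Sg.
Proof.
case: c => [[]|[f|] args] /=; last by rewrite nullary_hole.
move=> /hasP[_ /codomP[i ->] /= hi] e.
have := @term_size_arg _ _ f [ffun i => plug (args i) s] i.
by rewrite e ffunE ltnNge plug_size.
Qed.

Lemma plug_nohole (Sg : signature) (X : Type) (c : hole_term Sg)
    (s s' : term Sg X) : ~~ has_hole c -> plug c s = plug c s'.
Proof.
elim: c => [[]|[f|] args IH] //= hN.
congr App; apply/ffunP => i; rewrite !ffunE; apply: IH.
by apply: contra hN => hi; apply/hasP; exists true => //; apply/codomP; exists i.
Qed.

Lemma plug_inj2 (Sg : signature) (X : Type) (c d : hole_term Sg)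
    (s s' : term Sg X) :
  s <> s' -> plug c s = plug d s -> plug c s' = plug d s' -> c = d.
Proof.
move=> ns.
have hole_eq e : s = plug e s -> s' = plug e s' -> hole Sg = e.
  move=> e1 e2; case: (boolP (has_hole e)) => [he|/(plug_nohole s s')].
    by rewrite (plug_fix he (esym e1)).
  by rewrite -e1 -e2.
elim: c d => [[]|[f|] args IH] d; last by rewrite nullary_hole; apply: hole_eq.
case: d => [[]|[g|] args'] e1 e2; last first.
  by rewrite nullary_hole; apply/esym/hole_eq.
have efg : f = g by case: e1.
subst g; congr App; apply/ffunP => i; apply: IH.
  by have /ffunP/(_ i) := App_inj e1; rewrite !ffunE.
by have /ffunP/(_ i) := App_inj e2; rewrite !ffunE.
Qed.

Lemma ups_eval_lift (Sg : signature) (X : Type) (t : term Sg X) n :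
  ups_eval (lift_term t) n = t.
Proof.
elim: t => //= f args IH; congr App; apply/ffunP => i.
by rewrite !ffunE; apply: IH.
Qed.

Lemma ups_eval_app (Sg : signature) (X : Type) (c : ctx Sg) a b
    (t : term Sg X) n :
  ups_eval (ups_app c a b t) n = plug (ctx_pow c (a * n + b)) t.
Proof. by rewrite /= ffunE ups_eval_lift. Qed.

Lemma ups_app_inj (Sg : signature) (X : Type) (c c' : ctx Sg) a a' b b'
    (t t' : term Sg X) :
  ups_equiv (ups_app c a b t) (ups_app c' a' b' t') ->
  ctx_pow c a = ctx_pow c' a' /\ plug (ctx_pow c b) t = plug (ctx_pow c' b') t'.
Proof.
move=> e.
have := e 0; have := e 1; have := e 2; rewrite !ups_eval_app.
rewrite !muln2 -!addnn !muln1 !muln0 !add0n -!addnA !plug_powD.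
set u := plug (ctx_pow c b) t => e2 e1 e0; split=> //.
rewrite -e0 in e1; rewrite -e0 -e1 in e2.
have hc := has_hole_pow a (ctx_has_hole c).
have hc' := has_hole_pow a' (ctx_has_hole c').
case: (pselect (u = plug (ctx_pow c a) u)) => [eu|nu].
  rewrite (plug_fix hc (esym eu)).
  by rewrite -eu in e1; rewrite (plug_fix hc' (esym e1)).
exact: plug_inj2 nu e1 e2.
Qed.

Lemma upsilon_inv_exists (Sg : signature) (X : countType)
    (theta : subst (ups_sig Sg) X) :
  simple_subst theta -> exists vt, is_upsilon_inv theta vt.
Proof.
move=> hs.
have /choice[w hw] : forall x, exists w : ctx Sg * nat * nat * term Sg X,
    ups_equiv (theta x) (ups_app w.1.1.1 w.1.1.2 w.1.2 w.2).
  by move=> x; have [c [a [b [t h]]]] := hs x; exists (c, a, b, t).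
pose sg x := plug (ctx_pow (w x).1.1.1 (w x).1.1.2) (@Var Sg X x).
pose mu x := plug (ctx_pow (w x).1.1.1 (w x).1.2) (w x).2.
have [D hD] := subst_finite theta.
have hmu x : x \notin D -> mu x = Var x.
  move=> /hD ex; have := hw x 0.
  by rewrite ups_eval_app muln0 add0n ex /= => e0; apply/esym.
have hsg x : x \notin D -> sg x = Var x.
  move=> hx; have ex := hD _ hx; have := hw x 1.
  rewrite ups_eval_app muln1 plug_powD -/(mu x) hmu // ex /= => e1.
  exact/esym.
exists (Subst (ex_intro _ D hsg), Subst (ex_intro _ D hmu)) => x c a b t h.
have [] := @ups_app_inj _ _ (w x).1.1.1 c (w x).1.1.2 a (w x).1.2 b (w x).2 t.
  by move=> n; rewrite -hw h.
by move=> e1 e2; split=> //=; rewrite /sg e1.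
Qed.

Lemma is_upsilon_inv_unique (Sg : signature) (X : countType)
    (theta : subst (ups_sig Sg) X) vt vt' : simple_subst theta ->
  is_upsilon_inv theta vt -> is_upsilon_inv theta vt' ->
  vt.1 =1 vt'.1 /\ vt.2 =1 vt'.2.
Proof.
move=> hs h h'; split=> x; have [c [a [b [t e]]]] := hs x;
by have [e1 e2] := h _ _ _ _ _ e; have [e1' e2'] := h' _ _ _ _ _ e; congruence.
Qed.

Definition upsilon_inv (Sg : signature) (X : countType)
  (theta : subst (ups_sig Sg) X) (hs : simple_subst theta) : pat_subst Sg X :=
  sval (cid (upsilon_inv_exists hs)).

Lemma upsilon_invP (Sg : signature) (X : countType)
    (theta : subst (ups_sig Sg) X) (hs : simple_subst theta) :
  is_upsilon_inv theta (upsilon_inv hs).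
Proof. exact: svalP. Qed.

(* Main.v *)
(** Unification in the extended signature only decomposes equations between
    terms with the same head symbol and eliminates variables.  Evaluation at [n]
    turns the symbol [c^{a,b}] into the context [c^{a*n+b}], which contains a
    hole and is hence injective, so both kinds of steps remain equivalences after
    evaluation.  A unifier [rho] produced this way therefore satisfies
    [eta = rho(n) eta] for every unifier [eta] of the evaluated problem.  If
    [theta] is an mgu in the extended signature, [rho = theta delta] for some
    [delta], so [eta = theta(n) (delta(n) eta)]; and [theta(n)] is the value at
    [n] of [upsilon^{-1}(theta)]. *)
Require Import Defs.
From mathcomp Require Import all_boot.
From mathcomp Require Import boolp.
From Stdlib Require List.

Set Implicit Arguments.
Unset Strict Implicit.
Unset Printing Implicit Defensive.

(** * Substitution and the occurs check *)

Section Substitution.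

Variables (Sg : signature) (X : countType).
Implicit Types (t : term Sg X) (g : X -> term Sg X) (theta : subst Sg X).

Lemma app_fun_Var t : app_fun Var t = t.
Proof.
by elim: t => //= f args IH; congr App; apply/ffunP => i; rewrite ffunE IH.
Qed.

Lemma app_fun_comp g1 g2 t :
  app_fun g2 (app_fun g1 t) = app_fun (fun x => app_fun g2 (g1 x)) t.
Proof.
by elim: t => //= f args IH; congr App; apply/ffunP => i; rewrite !ffunE IH.
Qed.

Lemma app_comp_subst (theta1 theta2 : subst Sg X) t :
  app_fun (comp_subst theta1 theta2) t = app_fun theta2 (app_fun theta1 t).
Proof. by rewrite app_fun_comp. Qed.

Lemma mem_vars_App x (f : sym Sg) (args : {ffun 'I_(arity f) -> term Sg X}) :
  reflect (exists i, x \in vars (args i)) (x \in vars (App f args)).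
Proof.
apply: (iffP flattenP) => [[_ /codomP[i ->] hx]|[i hx]]; first by exists i.
by exists (vars (args i)); rewrite ?codom_f.
Qed.

Lemma eq_in_app_fun g1 g2 t :
  {in vars t, g1 =1 g2} -> app_fun g1 t = app_fun g2 t.
Proof.
elim: t => [x|f args IH] h /=; first by rewrite h ?mem_head.
congr App; apply/ffunP => i; rewrite !ffunE; apply: IH => x hx.
by apply: h; apply/mem_vars_App; exists i.
Qed.

Lemma term_size_app_var g x t :
  x \in vars t -> term_size (g x) <= term_size (app_fun g t).
Proof.
elim: t => [y|f args IH]; first by rewrite /= inE => /eqP->.
move=> /mem_vars_App[i /IH le_i]; apply: leq_trans le_i (ltnW _).
have := term_size_arg [ffun i => app_fun g (args i)] i.
by rewrite ffunE.
Qed.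

(** The occurs check, by size: if [x] lay strictly below the root of [t], its image under [g] would
    be a proper part of that of [t], hence strictly smaller. *)
Lemma unifier_occurs g x t :
  g x = app_fun g t -> t <> Var x -> x \notin vars t.
Proof.
case: t => [y|f args] e ne; first by
  rewrite inE; apply/eqP => exy; apply: ne; rewrite exy.
apply/mem_vars_App => -[i /(term_size_app_var g) le_i].
have := term_size_arg [ffun i => app_fun g (args i)] i.
by rewrite ffunE -[App f _]/(app_fun g (App f args)) -e ltnNge le_i.
Qed.

Definition elim_fun x t : X -> term Sg X :=
  fun y => if y == x then t else Var y.

Lemma elim_finite x t :
  exists D : seq X, forall y, y \notin D -> elim_fun x t y = Var y.
Proof. by exists [:: x] => y; rewrite inE /elim_fun => /negbTE->. Qed.

Definition elim_subst x t : subst Sg X := Subst (elim_finite x t).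

Lemma app_elim_notin x t : x \notin vars t -> app_fun (elim_subst x t) t = t.
Proof.
move=> hx; rewrite -[RHS]app_fun_Var; apply: eq_in_app_fun => y hy /=.
by rewrite /elim_fun; case: eqP => // eyx; rewrite eyx (negbTE hx) in hy.
Qed.

End Substitution.

(** * Unification of equations with a known solution *)

Section Unification.

Variables (Sg : signature) (X : countType).
Implicit Types (t : term Sg X) (E : seq (term Sg X * term Sg X)).

Definition satisfies (T : Type) (h : term Sg X -> T) E : Prop :=
  List.Forall (fun e => h e.1 = h e.2) E.

(* The common abstraction of applying a substitution and of evaluating at [n]  *)
(* before applying one.                                                        *)
Definition decomposing (T : Type) (h : term Sg X -> T) : Prop :=
  forall (f : sym Sg) (a b : {ffun 'I_(arity f) -> term Sg X}),
    h (App f a) = h (App f b) <-> forall i, h (a i) = h (b i).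

(** For [h := app_fun eta] the second clause reads [eta = rho eta], the property of an idempotent
    mgu. Letting [h] be any decomposing map makes the same [rho] serve the evaluated equations. *)
Definition principal E (rho : subst Sg X) : Prop :=
  satisfies (app_fun rho) E /\
  forall (T : Type) (h : term Sg X -> T), decomposing h -> satisfies h E ->
    forall x, h (rho x) = h (Var x).

Lemma decomposing_app_fun (g : X -> term Sg X) : decomposing (app_fun g).
Proof.
move=> f a b; split=> [/App_inj/ffunP e i|e].
  by have := e i; rewrite !ffunE.
by rewrite /=; congr App; apply/ffunP => i; rewrite !ffunE e.
Qed.

Lemma decomposing_fix (T : Type) (h : term Sg X -> T) (g : X -> term Sg X) :
  decomposing h -> (forall x, h (g x) = h (Var x)) ->
  forall t, h (app_fun g t) = h t.
Proof.
move=> dh hg; elim=> [x|f args IH]; first exact: hg.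
by apply/(dh f) => i; rewrite ffunE.
Qed.

Definition subst_eqs (theta : subst Sg X) E :=
  [seq (app_fun theta e.1, app_fun theta e.2) | e <- E].

Lemma satisfies_subst_eqs (T : Type) (h : term Sg X -> T) theta E :
  satisfies h (subst_eqs theta E) <-> satisfies (h \o app_fun theta) E.
Proof. exact: List.Forall_map. Qed.

Lemma satisfies_fix (T : Type) (h : term Sg X -> T) (theta : subst Sg X) E :
  decomposing h -> (forall x, h (theta x) = h (Var x)) ->
  satisfies (h \o app_fun theta) E <-> satisfies h E.
Proof.
move=> dh hx; have ht := decomposing_fix dh hx.
by split; apply: List.Forall_impl => e /=; rewrite !ht.
Qed.

Lemma principal_nil : principal [::] (id_subst Sg X).
Proof. by split; first exact: List.Forall_nil. Qed.

(** A map [h] solving all the equations absorbs [rho1], so it also solves the instantiated tail and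
    therefore absorbs [rho2]. *)
Lemma principal_cons e E rho1 rho2 :
  principal [:: e] rho1 -> principal (subst_eqs rho1 E) rho2 ->
  principal (e :: E) (comp_subst rho1 rho2).
Proof.
move=> [/List.Forall_cons_iff[u1 _] g1] [u2 g2]; split.
  apply: List.Forall_cons; first by rewrite !app_comp_subst u1.
  move/satisfies_subst_eqs: u2; apply: List.Forall_impl => e' /=.
  by rewrite !app_comp_subst.
move=> T h dh /List.Forall_cons_iff[he hE] x.
have h1 := g1 T h dh (List.Forall_cons _ he (List.Forall_nil _)).
have h2 : forall x, h (rho2 x) = h (Var x).
  by apply: g2 => //; apply/satisfies_subst_eqs/(satisfies_fix _ dh h1).
by rewrite /= /app_subst (decomposing_fix dh h2).
Qed.

Lemma principal_sym s t rho : principal [:: (s, t)] rho -> principal [:: (t, s)] rho.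
Proof.
move=> [/List.Forall_cons_iff[u _] g]; split.
  by apply: List.Forall_cons => //; apply: List.Forall_nil.
move=> T h dh /List.Forall_cons_iff[/= hu _]; apply: g => //.
by apply: List.Forall_cons => //; apply: List.Forall_nil.
Qed.

(** The solution [tau] passes the occurs check, so replacing [x] by [t] unifies; any [h] that
    equates [x] and [t] absorbs this replacement. *)
Lemma principal_var (tau : X -> term Sg X) x t :
  tau x = app_fun tau t -> exists rho, principal [:: (Var x, t)] rho.
Proof.
move=> e; case: (pselect (t = Var x)) => [->|ne].
  exists (id_subst Sg X); split=> //.
  by apply: List.Forall_cons => //; apply: List.Forall_nil.
exists (elim_subst x t); split.
  apply: List.Forall_cons; last exact: List.Forall_nil.
  by rewrite /= (app_elim_notin (unifier_occurs e ne)) /elim_fun eqxx.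
move=> T h dh /List.Forall_cons_iff[/= hu _] y.
by rewrite /= /elim_fun; case: eqP => // ->.
Qed.

Definition arg_eqs (f : sym Sg) (a b : {ffun 'I_(arity f) -> term Sg X}) :=
  [seq (a i, b i) | i <- enum 'I_(arity f)].

Lemma satisfies_arg_eqs (T : Type) (h : term Sg X -> T) (f : sym Sg)
    (a b : {ffun 'I_(arity f) -> term Sg X}) :
  satisfies h (arg_eqs a b) <-> forall i, h (a i) = h (b i).
Proof.
rewrite /satisfies List.Forall_map List.Forall_forall; split=> [H i|H i _]; last exact: H.
(* The hypothesis is stated with [List.In]; an induction along the enumeration passes from boolean
   membership to it. *)
have : i \in enum 'I_(arity f) by rewrite mem_enum.
move: (H i); elim: (enum _) => //= j s IH Hj.
rewrite inE => /orP[/eqP eij|hi]; first by apply: Hj; left.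
by apply: IH => // his; apply: Hj; right.
Qed.

Lemma principal_App (f : sym Sg) (a b : {ffun 'I_(arity f) -> term Sg X}) rho :
  principal (arg_eqs a b) rho -> principal [:: (App f a, App f b)] rho.
Proof.
move=> [/satisfies_arg_eqs u g]; split.
  apply: List.Forall_cons; last exact: List.Forall_nil.
  exact/decomposing_app_fun.
move=> T h dh /List.Forall_cons_iff[/= /dh hu _]; apply: g => //.
exact/satisfies_arg_eqs.
Qed.

(* The size of the equations after applying a known unifier is invariant under *)
(* variable elimination and decreases under decomposition: it bounds the       *)
(* recursion without counting variables.                                       *)
Lemma unifiable_principal (tau : X -> term Sg X) E :
  satisfies (app_fun tau) E -> exists rho, principal E rho.
Proof.
have [k] : exists k, List.Forall (fun e => term_size (app_fun tau e.1) < k) E.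
  elim: E => [|e E [k hk]]; first by exists 0; apply: List.Forall_nil.
  exists (maxn k (term_size (app_fun tau e.1)).+1).
  apply: List.Forall_cons; first exact: leq_maxr.
  by apply: List.Forall_impl hk => e' /leq_trans; apply; apply: leq_maxl.
elim: k E => [|k IHk] E.
  case: E => [|e E]; first by exists (id_subst Sg X); apply: principal_nil.
  by move=> /List.Forall_cons_iff[].
have dtau := decomposing_app_fun tau.
(* Inner induction on the number of equations: solving the head keeps the bound [k.+1] and shortens
   the list. *)
have [m] := ubnP (size E); elim: m E => // m IHm [|[s t] E].
  by exists (id_subst Sg X); apply: principal_nil.
rewrite /= ltnS => szE /List.Forall_cons_iff[/= hst hE].
move=> /List.Forall_cons_iff[/= ust uE].
have [rho1 p1] : exists rho, principal [:: (s, t)] rho.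
  case: s t hst ust => [x|f a] t hst ust; first exact: principal_var ust.
  case: t ust => [y|g b] ust.
    by have [rho /principal_sym] := principal_var (esym ust); exists rho.
  (* Substitution preserves head symbols, so solvability by [tau] excludes a clash. *)
  have efg : f = g by case: ust.
  subst g; have [|/=|rho hrho] := IHk (arg_eqs a b).
  - apply/List.Forall_map/List.Forall_forall => i _ /=.
    have := term_size_arg [ffun i => app_fun tau (a i)] i.
    by rewrite ffunE => /leq_trans; apply.
  - by apply/satisfies_arg_eqs/dtau.
  - by exists rho; apply: principal_App.
(* Applying [tau] is itself a decomposing map that solves the head equation, so it absorbs [rho1];
   size bound and solvability pass to the instantiated tail. *)
have h1 : forall x, app_fun tau (rho1 x) = app_fun tau (Var x).
  by case: p1 => _; apply=> //; apply: List.Forall_cons => //; apply: List.Forall_nil.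
have [||/=|rho2 p2] := IHm (subst_eqs rho1 E); first by rewrite size_map.
- apply/List.Forall_map; apply: List.Forall_impl hE => e /=.
  by rewrite (decomposing_fix dtau h1).
- by apply/satisfies_subst_eqs/(satisfies_fix _ dtau h1).
by exists (comp_subst rho1 rho2); apply: principal_cons.
Qed.

Lemma map_eq_satisfies (T : Type) (h : term Sg X -> T) (U V : seq (term Sg X)) :
  [seq h u | u <- U] = [seq h v | v <- V] <->
  size U = size V /\ satisfies h (zip U V).
Proof.
split=> [|[]].
  elim: U V => [|u U IH] [|v V] //=; first by split; last exact: List.Forall_nil.
  by case=> huv /IH[-> hs]; split=> //; apply: List.Forall_cons.
elim: U V => [|u U IH] [|v V] //= [/IH {}IH] /List.Forall_cons_iff[/= -> hs].
by rewrite IH.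
Qed.

End Unification.

(** * Evaluation at [n] and pattern substitutions *)

Section Evaluation.

Variables (Sg : signature) (X : countType).
Implicit Types (u : term (ups_sig Sg) X) (theta : subst (ups_sig Sg) X).

(** Descending along a path to some hole recovers the plugged term. *)
Lemma plug_inj (c : hole_term Sg) (s s' : term Sg X) :
  has_hole c -> plug c s = plug c s' -> s = s'.
Proof.
elim: c => [[]|[f|] args IH] //= /hasP[_ /codomP[i ->] /= hi].
by move=> /App_inj/ffunP/(_ i); rewrite !ffunE; apply: IH.
Qed.

Lemma app_fun_plug (g : X -> term Sg X) (c : hole_term Sg) s :
  app_fun g (plug c s) = plug c (app_fun g s).
Proof.
elim: c => [[]|[f|] args IH] //=.
by congr App; apply/ffunP => i; rewrite !ffunE IH.
Qed.

Lemma ups_eval_app_fun (g : X -> term (ups_sig Sg) X) u n :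
  ups_eval (app_fun g u) n = app_fun (fun x => ups_eval (g x) n) (ups_eval u n).
Proof.
elim: u => [//|[f|[[c a] b]] args IH] /=; last by rewrite app_fun_plug ffunE IH.
by congr App; apply/ffunP => i; rewrite !ffunE IH.
Qed.

Lemma decomposing_eval (g : X -> term Sg X) n :
  decomposing (fun u => app_fun g (ups_eval u n)).
Proof.
case=> [f|[[c a] b]] u v /=.
  split=> [/App_inj/ffunP e i|e]; first by have := e i; rewrite !ffunE.
  by congr App; apply/ffunP => i; rewrite !ffunE e.
rewrite !app_fun_plug; split=> [e i|-> //].
by rewrite (ord1 i); apply: plug_inj e; apply/has_hole_pow/ctx_has_hole.
Qed.

Lemma eval_finite theta n :
  exists D : seq X, forall x, x \notin D -> ups_eval (theta x) n = Var x.
Proof. by have [D hD] := subst_finite theta; exists D => x /hD ->. Qed.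

Definition eval_subst theta n : subst Sg X := Subst (eval_finite theta n).

Lemma mgu_eval (S1 S1' : seq (term (ups_sig Sg) X)) theta n :
  mgu S1 S1' theta ->
  mgu [seq ups_eval u n | u <- S1] [seq ups_eval u n | u <- S1']
      (eval_subst theta n).
Proof.
move=> [u_theta g_theta]; split.
  rewrite /unifier -!map_comp.
  have := congr1 (map (fun u => ups_eval u n)) u_theta; rewrite -!map_comp.
  have ev : (fun u => ups_eval u n) \o (fun u => app_subst u theta) =1
            (fun t => app_subst t (eval_subst theta n)) \o (fun u => ups_eval u n).
    by move=> u; apply: ups_eval_app_fun.
  by rewrite !(eq_map ev).
move=> eta; rewrite /unifier -!map_comp => /map_eq_satisfies[eq_size u_eta].
(* [eta] solves only the evaluated equations, so the generality of [theta] does not apply to it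
   directly; the principal [rho] obtained from [theta] mediates. *)
have /map_eq_satisfies[_ /unifiable_principal[rho [u_rho g_rho]]] := u_theta.
have [|delta rhoE] := g_theta rho.
  exact/(map_eq_satisfies (fun u => app_subst u rho)).
exists (comp_subst (eval_subst delta n) eta) => x.
have /= <- := g_rho _ _ (decomposing_eval eta n) u_eta x.
rewrite rhoE /= /app_subst ups_eval_app_fun.
by rewrite app_comp_subst.
Qed.

(** Contexts have no variables, so each further [sigma] acts only on the copies of [x] in the holes
    and inserts [c^a] there. *)
Lemma pow_subst_ctx (sigma : subst Sg X) x (c : hole_term Sg) a n :
  sigma x = plug (ctx_pow c a) (Var x) ->
  pow_subst sigma n x = plug (ctx_pow c (a * n)) (Var x).
Proof.
move=> e; elim: n => [|n IH] /=; first by rewrite muln0.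
by rewrite IH /app_subst app_fun_plug /= e -plug_powD mulnSr.
Qed.

Lemma pat_subst_eval_simple (vt : pat_subst Sg X) x c a b t n :
  simple_at vt x c a b t ->
  pat_subst_eval vt n x = ups_eval (ups_app c a b t) n.
Proof.
move=> [e1 e2]; rewrite ups_eval_app /= (pow_subst_ctx _ e1).
by rewrite /app_subst app_fun_plug /= e2 plug_powD.
Qed.

Lemma pat_subst_eval_fixed (vt : pat_subst Sg X) x n :
  vt.1 x = Var x -> pat_subst_eval vt n x = vt.2 x.
Proof.
by move=> e; rewrite /= (_ : pow_subst vt.1 n x = Var x) //; elim: n => //= n ->.
Qed.

(** Whatever decomposition is chosen at a variable [x], [theta x] evaluates to the value of the
    pattern substitution at [x]; the fixed and the moved variables are treated separately. *)
Lemma in_upsilon_eval (p : pat_term Sg X) u n :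
  in_upsilon p u -> ups_eval u n = pat_term_eval p n.
Proof.
move=> [theta [th_p eu]]; rewrite eu /app_subst ups_eval_app_fun ups_eval_lift.
rewrite /pat_term_eval /app_subst app_fun_comp; apply: eq_in_app_fun => x hx.
rewrite -[RHS]/(pat_subst_eval p.2 n x); have [fixed moved] := th_p x hx.
case: (pselect (p.2.1 x = Var x)) => [ex|/moved[c [a [b [t [hc ->]]]]]].
  by rewrite fixed // ups_eval_lift pat_subst_eval_fixed.
by rewrite (pat_subst_eval_simple _ hc).
Qed.

Lemma in_upsilon_seq_eval (S : seq (pat_term Sg X)) S1 n :
  in_upsilon_seq S S1 ->
  [seq pat_term_eval p n | p <- S] = [seq ups_eval u n | u <- S1].
Proof. by elim=> //= p u {}S {}S1 /in_upsilon_eval -> _ ->. Qed.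

Lemma upsilon_inv_eval theta (hs : simple_subst theta) n :
  pat_subst_eval (upsilon_inv hs) n =1 eval_subst theta n.
Proof.
move=> x; have [c [a [b [t e]]]] := hs x.
by rewrite (pat_subst_eval_simple _ (upsilon_invP hs e)) -e.
Qed.

(** Both clauses of [mgu] depend on a substitution only through its values at variables. *)
Lemma eq_mgu (T T' : seq (term Sg X)) (theta1 theta2 : subst Sg X) :
  theta1 =1 theta2 -> mgu T T' theta1 -> mgu T T' theta2.
Proof.
move=> e12 [u1 g1].
have e t : app_subst t theta1 = app_subst t theta2.
  by apply: eq_in_app_fun => x _.
split; first by rewrite /unifier -!(eq_map e).
move=> eta /g1[delta etaE]; exists delta => x.
by rewrite etaE /= e12.
Qed.

End Evaluation.

Theorem theorem4p11 (Sg : signature) (X : countType)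
  (X_infinite : forall D : seq X, exists x : X, x \notin D)
  (S S' : seq (pat_term Sg X))
  (S_simple : forall p, List.In p S -> simple_pat_term p)
  (S'_simple : forall p, List.In p S' -> simple_pat_term p)
  (S1 S1' : seq (term (ups_sig Sg) X))
  (S1_ups : in_upsilon_seq S S1)
  (S1'_ups : in_upsilon_seq S' S1')
  (theta : subst (ups_sig Sg) X)
  (theta_mgu : mgu S1 S1' theta)
  (theta_simple : simple_subst theta) :
  pat_mgu S S' (upsilon_inv theta_simple).
Proof.
move=> n; rewrite (in_upsilon_seq_eval n S1_ups) (in_upsilon_seq_eval n S1'_ups).
by apply: eq_mgu (fsym (upsilon_inv_eval theta_simple n)) (mgu_eval n theta_mgu).
Qed.
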